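(* Let $\mathcal{H}_1,\mathcal{H}_2$ be right quaternionic Hilbert spaces, $K_1 \in \mathbb{B}(\mathcal{H}_1)$ and $K_2 \in \mathbb{B}(\mathcal{H}_2)$. Let $\{u_i\}_{i \in I}$ be a $K_1$-frame for $\mathcal{H}_1$ and $\{v_i\}_{i \in I}$ be a $K_2$-frame for $\mathcal{H}_2$, with synthesis operators $T_1$ and $T_2$ respectively. If $\{u_i \oplus v_i\}_{i \in I}$ is a $K_1 \oplus K_2$-frame for $\mathcal{H}_1 \oplus \mathcal{H}_2$, then $$R(K_1) \subset T_1(N(T_2))\quad\text{and}\quad R(K_2) \subset T_2(N(T_1)).$$
   Context: $\mathbb{H}$ denotes the skew field of quaternions. A right quaternionic Hilbert space is a right $\mathbb{H}$-vector space with an inner product $\langle\cdot,\cdot\rangle$ valued in $\mathbb{H}$ satisfying $\langle u,v\rangle=\overline{\langle v,u\rangle}$, $\langle u,u\rangle>0$ for $u\neq 0$, additivity in the second variable and $\langle u,vq\rangle=\langle u,v\rangle q$ for $q\in\mathbb{H}$, complete for the norm $\|u\|=\sqrt{\langle u,u\rangle}$. $\mathbb{B}(\mathcal{H})$ is the set of bounded right $\mathbb{H}$-linear operators on $\mathcal{H}$; $L^*$ is the adjoint, $R(L)$ the range and $N(L)$ the kernel of $L$. $I$ is a countable index set, and $\ell^2(\mathbb{H})=\{\{q_i\}_{i\in I}\subset\mathbb{H}:\sum_{i\in I}|q_i|^2<\infty\}$ with $\langle p,q\rangle=\sum_{i\in I}\overline{p_i}q_i$. The direct sum $\mathcal{H}_1\oplus\mathcal{H}_2$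 carries the inner product $\langle u_1\oplus v_1,u_2\oplus v_2\rangle=\langle u_1,u_2\rangle+\langle v_1,v_2\rangle$ and is a right quaternionic Hilbert space. $K_1\oplus K_2$ is the operator $(K_1\oplus K_2)(u\oplus v)=K_1u\oplus K_2v$. For $K\in\mathbb{B}(\mathcal{H})$, a sequence $\{w_i\}_{i\in I}$ in $\mathcal{H}$ is a $K$-frame for $\mathcal{H}$ if there are $0<A\le B<\infty$ with $A\|K^*u\|^2\le\sum_{i\in I}|\langle w_i,u\rangle|^2\le B\|u\|^2$ for all $u\in\mathcal{H}$. The synthesis (pre-frame) operator of such a sequence is the bounded operator $T:\ell^2(\mathbb{H})\to\mathcal{H}$, $T(\{q_i\}_{i\in I})=\sum_{i\in I}w_iq_i$. *)

(* Defs.v *)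
From HB Require Import structures.
From mathcomp Require Import all_boot all_order all_algebra.
From mathcomp Require Import ring lra.
From mathcomp Require Import finmap.
From mathcomp Require Import all_classical all_reals all_analysis.
From mathcomp.analysis.showcase Require summability.

Set Implicit Arguments.
Unset Strict Implicit.
Unset Printing Implicit Defensive.

Import Order.TTheory GRing.Theory Num.Theory.
Import numFieldNormedType.Exports.

Local Open Scope classical_set_scope.
Local Open Scope ring_scope.

(* [Quat a b c d] is a + b i + c j + d k. *)
Record quat (R : realType) := Quat { qre : R; qim : R; qjm : R; qkm : R }.

Section Quaternions.
Variable R : realType.
Implicit Types p q : quat R.

Definition quat_tuple p := (qre p, qim p, qjm p, qkm p).
Definition tuple_quat (t : R * R * R * R) :=
  let: (a, b, c, d) := t in Quat a b c d.
Lemma quat_tupleK : cancel quat_tuple tuple_quat. Proof. by case. Qed.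

HB.instance Definition _ := Choice.copy (quat R) (can_type quat_tupleK).

Definition addq p q :=
  Quat (qre p + qre q) (qim p + qim q) (qjm p + qjm q) (qkm p + qkm q).
Definition oppq p := Quat (- qre p) (- qim p) (- qjm p) (- qkm p).
Definition zeroq : quat R := Quat 0 0 0 0.

Lemma addqA : associative addq.
Proof. by move=> [? ? ? ?] [? ? ? ?] [? ? ? ?]; congr Quat; exact: addrA. Qed.
Lemma addqC : commutative addq.
Proof. by move=> [? ? ? ?] [? ? ? ?]; congr Quat; exact: addrC. Qed.
Lemma add0q : left_id zeroq addq.
Proof. by move=> [? ? ? ?]; congr Quat; exact: add0r. Qed.
Lemma addNq : left_inverse zeroq oppq addq.
Proof. by move=> [? ? ? ?]; congr Quat; exact: addNr. Qed.

HB.instance Definition _ := GRing.isZmodule.Build (quat R) addqA addqC add0q addNq.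

Definition oneq : quat R := Quat 1 0 0 0.
Definition mulq p q := Quat
  (qre p * qre q - qim p * qim q - qjm p * qjm q - qkm p * qkm q)
  (qre p * qim q + qim p * qre q + qjm p * qkm q - qkm p * qjm q)
  (qre p * qjm q - qim p * qkm q + qjm p * qre q + qkm p * qim q)
  (qre p * qkm q + qim p * qjm q - qjm p * qim q + qkm p * qre q).

Lemma mulqA : associative mulq.
Proof. by move=> [? ? ? ?] [? ? ? ?] [? ? ? ?]; congr Quat => /=; ring. Qed.
Lemma mul1q : left_id oneq mulq.
Proof. by move=> [? ? ? ?]; congr Quat => /=; ring. Qed.
Lemma mulq1 : right_id oneq mulq.
Proof. by move=> [? ? ? ?]; congr Quat => /=; ring. Qed.
Lemma mulqDl : left_distributive mulq addq.
Proof. by move=> [? ? ? ?] [? ? ? ?] [? ? ? ?]; congr Quat => /=; ring. Qed.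
Lemma mulqDr : right_distributive mulq addq.
Proof. by move=> [? ? ? ?] [? ? ? ?] [? ? ? ?]; congr Quat => /=; ring. Qed.
Lemma oneq_neq0 : oneq != zeroq.
Proof. by apply/eqP => -[] /eqP; rewrite oner_eq0. Qed.

HB.instance Definition _ := GRing.Zmodule_isNzRing.Build (quat R)
  mulqA mul1q mulq1 mulqDl mulqDr oneq_neq0.

Definition conjq p : quat R := Quat (qre p) (- qim p) (- qjm p) (- qkm p).

Definition normquat p : R :=
  Num.sqrt (qre p ^+ 2 + qim p ^+ 2 + qjm p ^+ 2 + qkm p ^+ 2).

Let sqnorm_ge0 p : 0 <= qre p ^+ 2 + qim p ^+ 2 + qjm p ^+ 2 + qkm p ^+ 2.
Proof. by rewrite !addr_ge0 ?sqr_ge0. Qed.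

Lemma ler_normqD p q : normquat (p + q) <= normquat p + normquat q.
Proof.
have p0 := sqrtr_ge0 (qre p ^+ 2 + qim p ^+ 2 + qjm p ^+ 2 + qkm p ^+ 2).
have q0 := sqrtr_ge0 (qre q ^+ 2 + qim q ^+ 2 + qjm q ^+ 2 + qkm q ^+ 2).
rewrite -(@ler_pXn2r _ 2) ?nnegrE ?sqrtr_ge0 ?addr_ge0//.
rewrite sqrrD !sqr_sqrtr ?sqnorm_ge0// /normquat -sqrtrM ?sqnorm_ge0//.
case: p q {p0 q0} => [a b c d] [e f g h] /=.
set S := _ * _.
suff : a * e + b * f + c * g + d * h <= Num.sqrt S by lra.
apply: (le_trans (ler_norm _)); rewrite -sqrtr_sqr ler_wsqrtr// /S.
have := sqr_ge0 (a * f - b * e); have := sqr_ge0 (a * g - c * e).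
have := sqr_ge0 (a * h - d * e); have := sqr_ge0 (b * g - c * f).
have := sqr_ge0 (b * h - d * f); have := sqr_ge0 (c * h - d * g).
lra.
Qed.

Lemma normq0_eq0 p : normquat p = 0 -> p = 0.
Proof.
move/eqP; rewrite sqrtr_eq0 => p0; have := sqnorm_ge0 p; case: p p0 => a b c d /=.
have := sqr_ge0 a; have := sqr_ge0 b; have := sqr_ge0 c; have := sqr_ge0 d.
move=> d0 c0 b0 a0 s0 _.
have eq0 (x : R) : x ^+ 2 <= 0 -> x = 0.
  by move=> x0; apply/eqP; rewrite -sqrf_eq0 eq_le x0 sqr_ge0.
by congr Quat; apply: eq0; lra.
Qed.

Lemma normqMn p n : normquat (p *+ n) = normquat p *+ n.
Proof.
have -> : p *+ n = Quat (qre p *+ n) (qim p *+ n) (qjm p *+ n) (qkm p *+ n).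
  elim: n => [|n IH]; first by rewrite !mulr0n.
  by rewrite mulrS IH; congr Quat; rewrite mulrS.
rewrite /normquat /= !exprMn_n -!mulrnDl -[X in Num.sqrt X]mulr_natr natrX.
by rewrite sqrtrM ?sqnorm_ge0// sqrtr_sqr ger0_norm// mulr_natr.
Qed.

Lemma normqN p : normquat (- p) = normquat p.
Proof. by rewrite /normquat /= !sqrrN. Qed.

HB.instance Definition _ := Num.Zmodule_isNormed.Build R (quat R)
  ler_normqD normq0_eq0 normqMn normqN.

End Quaternions.

(* Right H-vector spaces are axiomatized directly instead of as left modules over
   (quat R)^c: in the library, a structure that joins a topology and an Lmodule
   must have a numDomainType of scalars. *)
HB.mixin Record Zmodule_isRightQuatModule (R : realType) V & GRing.Zmodule V := {
  rscale : V -> quat R -> V;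
  rscaleA : forall u p q, rscale (rscale u p) q = rscale u (p * q);
  rscale1 : forall u, rscale u 1 = u;
  rscaleDl : forall u v q, rscale (u + v) q = rscale u q + rscale v q;
  rscaleDr : forall u p q, rscale u (p + q) = rscale u p + rscale u q
}.

#[short(type="rightQuatModType")]
HB.structure Definition RightQuatModule (R : realType) :=
  {V of GRing.Zmodule V & Zmodule_isRightQuatModule R V}.

HB.mixin Record isQHilbert (R : realType) V
    & PseudoMetricNormedZmod R V & RightQuatModule R V := {
  qdot : V -> V -> quat R;
  qdotC : forall u v, qdot u v = conjq (qdot v u);
  (* by [qdotC], <u, u> has no imaginary part *)
  qdot_gt0 : forall u, u != 0 -> 0 < qre (qdot u u);
  qdotDr : forall u v w, qdot u (v + w) = qdot u v + qdot u w;
  qdotZr : forall u v q, qdot u (rscale v q) = qdot u v * q;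
  qnormE : forall u, `|u| = Num.sqrt (qre (qdot u u));
  (* completeness, as in [completeType] *)
  qcauchy_cvg : forall F : set_system V, ProperFilter F -> cauchy F -> cvg F
}.

#[short(type="qHilbertType")]
HB.structure Definition QHilbert (R : realType) :=
  {V of PseudoMetricNormedZmod R V & RightQuatModule R V & isQHilbert R V}.

Section DirectSum.
Variables (R : realType) (V W : qHilbertType R).

(* An alias of V * W: the canonical norm of V * W is the maximum of the norms
   of the components, not the one induced by the inner product. *)
Definition dsum : Type := (V * W)%type.
Definition dsum_pair (u : V) (v : W) : dsum := (u, v).

HB.instance Definition _ := GRing.Zmodule.copy dsum (V * W)%type.

Implicit Types x y z : dsum.

Definition normds x : R := Num.sqrt (`|x.1| ^+ 2 + `|x.2| ^+ 2).

Lemma ler_normdsD x y : normds (x + y) <= normds x + normds y.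
Proof.
rewrite /normds -[leRHS]ger0_norm ?addr_ge0 ?sqrtr_ge0// -sqrtr_sqr.
rewrite ler_wsqrtr// sqrrD !sqr_sqrtr ?addr_ge0 ?sqr_ge0// -sqrtrM ?addr_ge0 ?sqr_ge0//.
have n1 : `|(x + y).1| ^+ 2 <= (`|x.1| + `|y.1|) ^+ 2.
  by rewrite lerXn2r ?nnegrE ?addr_ge0// ler_normD.
have n2 : `|(x + y).2| ^+ 2 <= (`|x.2| + `|y.2|) ^+ 2.
  by rewrite lerXn2r ?nnegrE ?addr_ge0// ler_normD.
move: n1 n2; rewrite !sqrrD => n1 n2.
set S := _ * (_ + _).
suff : `|x.1| * `|y.1| + `|x.2| * `|y.2| <= Num.sqrt S.
  lra.
apply: (le_trans (ler_norm _)); rewrite -sqrtr_sqr ler_wsqrtr// /S.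
have := sqr_ge0 (`|x.1| * `|y.2| - `|x.2| * `|y.1|).
lra.
Qed.

Lemma normds0_eq0 x : normds x = 0 -> x = 0.
Proof.
case: x => u v /eqP; rewrite sqrtr_eq0 /= => x0.
have : `|u| ^+ 2 = 0 /\ `|v| ^+ 2 = 0.
  by have := sqr_ge0 `|u|; have := sqr_ge0 `|v|; split; lra.
by case=> /eqP; rewrite sqrf_eq0 normr_eq0 => /eqP -> /eqP;
  rewrite sqrf_eq0 normr_eq0 => /eqP ->.
Qed.

Lemma normdsMn x n : normds (x *+ n) = normds x *+ n.
Proof.
have -> : x *+ n = (x.1 *+ n, x.2 *+ n).
  by elim: n => [|n IH]; rewrite ?mulr0n// !mulrS IH.
rewrite /normds /= !normrMn !exprMn_n -mulrnDl -[X in Num.sqrt X]mulr_natr natrX.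
by rewrite sqrtrM ?addr_ge0 ?sqr_ge0// sqrtr_sqr ger0_norm// mulr_natr.
Qed.

Lemma normdsN x : normds (- x) = normds x.
Proof. by rewrite /normds /= !normrN. Qed.

HB.instance Definition _ := Num.Zmodule_isNormed.Build R dsum
  ler_normdsD normds0_eq0 normdsMn normdsN.
HB.instance Definition _ := PseudoMetric.copy dsum (pseudoMetric_normed dsum).
HB.instance Definition _ := isPointed.Build dsum 0.
HB.instance Definition _ := NormedZmod_PseudoMetric_eq.Build R dsum erefl.

Lemma normdsE x : `|x| = Num.sqrt (`|x.1| ^+ 2 + `|x.2| ^+ 2).
Proof. by []. Qed.

Lemma norm1_le_dsum x : `|x.1| <= `|x|.
Proof.
by rewrite normdsE -[leLHS]ger0_norm// -sqrtr_sqr ler_wsqrtr// lerDl sqr_ge0.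
Qed.

Lemma norm2_le_dsum x : `|x.2| <= `|x|.
Proof.
by rewrite normdsE -[leLHS]ger0_norm// -sqrtr_sqr ler_wsqrtr// lerDr sqr_ge0.
Qed.

Lemma norm_dsum_le x : `|x| <= `|x.1| + `|x.2|.
Proof.
rewrite normdsE -[leRHS]ger0_norm ?addr_ge0// -sqrtr_sqr ler_wsqrtr//.
by rewrite sqrrD -addrA lerD2l lerDr mulrn_wge0// mulr_ge0.
Qed.

Lemma dsum_complete (F : set_system dsum) : ProperFilter F -> cauchy F -> cvg F.
Proof.
move=> FF /cauchyP Fc.
have /qcauchy_cvg/cvg_ex[/= l1 Fl1] : cauchy ((fun x : dsum => x.1) @ F).
  apply/cauchyP => e e0; have [x Fx] := Fc e e0; exists x.1.
  apply: (@filterS _ F _ (ball x e)) => // y; rewrite -!ball_normE /=.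
  by apply: le_lt_trans; exact: (norm1_le_dsum (x - y)).
have /qcauchy_cvg/cvg_ex[/= l2 Fl2] : cauchy ((fun x : dsum => x.2) @ F).
  apply/cauchyP => e e0; have [x Fx] := Fc e e0; exists x.2.
  apply: (@filterS _ F _ (ball x e)) => // y; rewrite -!ball_normE /=.
  by apply: le_lt_trans; exact: (norm2_le_dsum (x - y)).
apply/cvg_ex; exists (dsum_pair l1 l2); apply/fcvgrPdist_lt => e e0.
have e20 : 0 < e / 2 by rewrite divr_gt0.
move/cvgrPdist_lt/(_ _ e20) : Fl1 => F1; move/cvgrPdist_lt/(_ _ e20) : Fl2 => F2.
near=> x; apply: le_lt_trans (norm_dsum_le _) _.
rewrite (splitr e) ltrD//; first by near: x; exact: F1.
by near: x; exact: F2.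
Unshelve. all: by end_near. Qed.

Definition rscaleds x (q : quat R) : dsum := (rscale x.1 q, rscale x.2 q).

Lemma rscaledsA x p q : rscaleds (rscaleds x p) q = rscaleds x (p * q).
Proof. by congr pair; exact: rscaleA. Qed.
Lemma rscaleds1 x : rscaleds x 1 = x.
Proof. by case: x => u v; congr pair; exact: rscale1. Qed.
Lemma rscaledsDl x y q : rscaleds (x + y) q = rscaleds x q + rscaleds y q.
Proof. by congr pair; exact: rscaleDl. Qed.
Lemma rscaledsDr x p q : rscaleds x (p + q) = rscaleds x p + rscaleds x q.
Proof. by congr pair; exact: rscaleDr. Qed.

HB.instance Definition _ := Zmodule_isRightQuatModule.Build R dsum
  rscaledsA rscaleds1 rscaledsDl rscaledsDr.

Definition qdotds x y : quat R := qdot x.1 y.1 + qdot x.2 y.2.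

Lemma conjqD (p q : quat R) : conjq (p + q) = conjq p + conjq q.
Proof. by congr Quat => /=; rewrite opprD. Qed.

Lemma qdot_ge0 (H : qHilbertType R) (u : H) : 0 <= qre (qdot u u).
Proof.
have [->|u0] := eqVneq u 0; last exact/ltW/qdot_gt0.
suff -> : qdot (0 : H) 0 = 0 by [].
by apply: (@addrI _ (qdot (0 : H) 0)); rewrite -qdotDr !addr0.
Qed.

Lemma sqr_qnorm (H : qHilbertType R) (u : H) : `|u| ^+ 2 = qre (qdot u u).
Proof. by rewrite qnormE sqr_sqrtr// qdot_ge0. Qed.

Lemma qdotdsC x y : qdotds x y = conjq (qdotds y x).
Proof. by rewrite /qdotds conjqD -!qdotC. Qed.

Lemma qdotds_normE x : `|x| = Num.sqrt (qre (qdotds x x)).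
Proof. by rewrite normdsE !sqr_qnorm. Qed.

Lemma qdotds_gt0 x : x != 0 -> 0 < qre (qdotds x x).
Proof. by rewrite -normr_gt0 qdotds_normE sqrtr_gt0. Qed.

Lemma qdotdsDr x y z : qdotds x (y + z) = qdotds x y + qdotds x z.
Proof. by rewrite /qdotds !qdotDr addrACA. Qed.

Lemma qdotdsZr x y q : qdotds x (rscale y q) = qdotds x y * q.
Proof. by rewrite /qdotds !qdotZr mulrDl. Qed.

HB.instance Definition _ := isQHilbert.Build R dsum
  qdotdsC qdotds_gt0 qdotdsDr qdotdsZr qdotds_normE dsum_complete.

End DirectSum.

Section BoundedOperators.
Variable R : realType.

Record bounded_op (H : qHilbertType R) := BoundedOp {
  bop_fun :> H -> H;
  bopD : forall u v, bop_fun (u + v) = bop_fun u + bop_fun v;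
  bopZ : forall u q, bop_fun (rscale u q) = rscale (bop_fun u) q;
  bop_bounded : exists M, forall u, `|bop_fun u| <= M * `|u|
}.

(* [adjoint L u] is the vector that represents v |-> <u, L v>: it is unique,
   and it exists by the Riesz representation theorem, so that the default
   value 0 is never used. *)
Definition adjoint (H : qHilbertType R) (L : bounded_op H) (u : H) : H :=
  xget 0 [set u' | forall v, qdot u' v = qdot u (L v)].

Section DirectSumOp.
Variables (V W : qHilbertType R) (K : bounded_op V) (L : bounded_op W).

Definition dsum_fun (x : dsum V W) : dsum V W := dsum_pair (K x.1) (L x.2).

Lemma dsum_funD x y : dsum_fun (x + y) = dsum_fun x + dsum_fun y.
Proof. by congr pair; exact: bopD. Qed.

Lemma dsum_funZ x q : dsum_fun (rscale x q) = rscale (dsum_fun x) q.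
Proof. by congr pair; exact: bopZ. Qed.

Lemma dsum_fun_bounded : exists M, forall x, `|dsum_fun x| <= M * `|x|.
Proof.
have [M KM] := bop_bounded K; have [N LN] := bop_bounded L.
exists (`|M| + `|N|) => x; apply: (le_trans (norm_dsum_le _)).
rewrite mulrDl lerD//=.
- rewrite (le_trans (KM _))// (le_trans (ler_norm _))// normrM normr_id.
  by rewrite ler_wpM2l// norm1_le_dsum.
- rewrite (le_trans (LN _))// (le_trans (ler_norm _))// normrM normr_id.
  by rewrite ler_wpM2l// norm2_le_dsum.
Qed.

Definition dsum_op : bounded_op (dsum V W) :=
  BoundedOp dsum_funD dsum_funZ dsum_fun_bounded.

End DirectSumOp.
End BoundedOperators.

Section Frames.
Variables (R : realType) (I : countType) (H : qHilbertType R).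

Definition l2 := {q : I -> quat R |
  (\esum_(i in [set: I]) (`|q i| ^+ 2)%:E < +oo)%E}.

Definition is_Kframe (K : bounded_op H) (w : I -> H) :=
  exists A B : R, [/\ 0 < A, A <= B & forall u : H,
    ((A * `|adjoint K u| ^+ 2)%:E
       <= \esum_(i in [set: I]) (`|qdot (w i) u| ^+ 2)%:E
       <= (B * `|u| ^+ 2)%:E)%E].

(* The sum is the limit of the finite partial sums along the directed set of
   finite subsets of I; it converges as soon as w satisfies the upper frame
   bound. *)
Definition synthesis (w : I -> H) (q : l2) : H :=
  lim (summability.partial_sum (fun i => rscale (w i) (sval q i))
         @ summability.totally).

Definition ker (f : l2 -> H) : set l2 := [set q | f q = 0].

End Frames.

(* Main.v *)
Require Import Defs.
From HB Require Import structures.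
From mathcomp Require Import all_boot all_order all_algebra.
From mathcomp Require Import ring lra.
From mathcomp Require Import finmap.
From mathcomp Require Import all_classical all_reals all_analysis.
From mathcomp.analysis.showcase Require summability.

Set Implicit Arguments.
Unset Strict Implicit.
Unset Printing Implicit Defensive.

Import Order.TTheory GRing.Theory Num.Theory.
Import numFieldNormedType.Exports.

Local Open Scope classical_set_scope.
Local Open Scope ring_scope.

(** The theorem is one half of Douglas's range inclusion lemma applied to the
  direct sum.  Let [T] be the synthesis operator of a [K]-frame [w] of [H].
  The lower frame bound says [A |K^* z|^2 <= |T^* z|^2], hence for every [x]
  the functional [z |-> Re <K x, z> = Re <K^* z, x>] is dominated by
  [|x| A^{-1/2} |T^* z|]: it factors through [T^*], and a representing sequence
  [q] of the factorization satisfies [Re <T q, z> = Re <K x, z>] for all [z],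
  so that [T q = K x].  This is [Kframe_range].  For the frame
  [u_i (+) v_i] and the vectors [K1 x (+) 0] and [0 (+) K2 x] it yields
  sequences with [T1 q = K1 x, T2 q = 0] and [T1 q = 0, T2 q = K2 x].

  Two representation arguments occur: the existence of [K^*], and that of [q].
  Both rest on [near_representation], a version of the Riesz theorem for a
  positive form on a space that is neither complete nor separated: a bounded
  functional is represented up to [e], and two vectors that do so are
  [2 sqrt e]-close for the form.  For the inner product of [H], the
  near-representatives converge in [H] and give [K^*].  For the form
  [<T^* x, T^* z>] they need not converge in [H], but their coefficients
  [<w_i, x_n>] converge for each [i], uniformly in square sum; the limits form
  [q].

  Only real parts of inner products are needed throughout: [Re <., .>] is a
  real inner product that separates vectors, and the quaternionic identities
  follow by right linearity ([qdot_rdotP]). *)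

(** * Almost representing functionals for positive forms *)

(** The discriminant criterion; [Q = 0] is allowed because the forms it is used
  for are only semidefinite. *)
Lemma sqr_le_of_quadratic (R : realType) (e b Q : R) : 0 <= Q ->
  (forall t, 0 <= e + t * b *+ 2 + t ^+ 2 * Q) -> b ^+ 2 <= e * Q.
Proof.
move=> Q0 pos; have [Qz|Qn] := eqVneq Q 0.
  have [->|b0] := eqVneq b 0; first by rewrite Qz expr0n mulr0.
  have := pos (- (e + 1) / b); have := pos 0.
  rewrite Qz !mulr0 mul0r mul0rn !addr0 divfK// => e0; lra.
have Qp : 0 < Q by rewrite lt_neqAle eq_sym Qn.
have := pos (- b / Q).
have -> : e + - b / Q * b *+ 2 + (- b / Q) ^+ 2 * Q = e - b ^+ 2 / Q by field.
by rewrite subr_ge0 ler_pdivrMr.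
Qed.

Definition real_quat (R : realType) (t : R) : quat R := Quat t 0 0 0.

Section PositiveForms.
Variables (R : realType) (V : rightQuatModType R) (B : V -> V -> R).
Hypothesis BC : forall x y, B x y = B y x.
Hypothesis BDr : forall x y z, B x (y + z) = B x y + B x z.
Hypothesis BZr : forall x y t, B x (rscale y (real_quat t)) = B x y * t.
Hypothesis B_ge0 : forall x, 0 <= B x x.

Lemma form_expand x y t :
  B (x + rscale y (real_quat t)) (x + rscale y (real_quat t)) =
  B x x + t * B x y *+ 2 + t ^+ 2 * B y y.
Proof.
rewrite BDr BZr ![B (x + _) _]BC !BDr !BZr [B y x]BC; ring.
Qed.

Lemma form_Cauchy_Schwarz x y : B x y ^+ 2 <= B x x * B y y.
Proof.
apply: sqr_le_of_quadratic => // t; rewrite -form_expand; exact: B_ge0.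
Qed.

(** A near-minimizer [x] of [B z z - 2 f z] does it: moving from [x] along any
  [y] cannot decrease this by more than [e], and the discriminant criterion in
  the step length turns this into the estimate. *)
Lemma near_representation (f : V -> R) (C : R) :
  (forall x y, f (x + y) = f x + f y) ->
  (forall x t, f (rscale x (real_quat t)) = f x * t) ->
  0 <= C -> (forall x, f x ^+ 2 <= C * B x x) ->
  forall e, 0 < e -> exists x, forall y, (B x y - f y) ^+ 2 <= e * B y y.
Proof.
move=> fD fZ C0 fC e e0; pose J x := B x x - f x *+ 2.
(* 2 f x <= B x x + C is the AM-GM consequence of the bound on f *)
have JC x : - C <= J x.
  rewrite /J; suff : f x *+ 2 <= B x x + C by lra.
  have := fC x; have := B_ge0 x; set b := B x x => b0 fb.
  apply: (le_trans (ler_norm _)); rewrite -ler_sqr ?nnegrE ?addr_ge0//.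
  rewrite real_normK ?num_real//.
  by have := sqr_ge0 (b - C); rewrite -mulr_natr; lra.
have hJ : has_inf (range J).
  by split; [exists (J 0), 0|exists (- C) => _ [x _ <-]].
have [_ [x _ <-] xm] := inf_adherent e0 hJ.
exists x => y; apply: sqr_le_of_quadratic => // t.
have : inf (range J) <= J (x + rscale y (real_quat t)).
  by apply: ge_inf; [exact: hJ.2|exists (x + rscale y (real_quat t))].
rewrite /J in xm *; rewrite form_expand fD fZ; lra.
Qed.

(** Test both estimates at [d = x - x']: then [B d d] is a difference of two
  numbers of size at most [sqrt (e * B d d)]. *)
Lemma near_representation_close (f : V -> R) (x x' : V) (e : R) :
  0 <= e ->
  (forall y, (B x y - f y) ^+ 2 <= e * B y y) ->
  (forall y, (B x' y - f y) ^+ 2 <= e * B y y) ->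
  B (x - x') (x - x') <= 4 * e.
Proof.
move=> e0 h h'; set d := x - x'.
have Bd : B d d = (B x d - f d) - (B x' d - f d).
  have -> : B x d = B x' d + B d d by rewrite BC [B x' d]BC -BDr subrKC.
  ring.
have := h d; have := h' d; move: Bd (B_ge0 d).
move: (B d d) (B x d - f d) (B x' d - f d) => Q a b Bd.
rewrite le_eqVlt => /orP[/eqP <- _ _|Q0 hb ha]; first by rewrite mulr_ge0.
rewrite -(ler_pM2r Q0) {1 2}Bd.
have := sqr_ge0 (a + b); lra.
Qed.

End PositiveForms.

(** * Convergence of sequences *)

Lemma exists_invS_lt (R : realType) (e : R) : 0 < e ->
  exists N : nat, N.+1%:R^-1 < e.
Proof.
move=> e0; exists (Num.bound e^-1); rewrite invf_plt ?posrE//.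
apply: (lt_trans (archi_boundP _)); first by rewrite invr_ge0 ltW.
by rewrite ltr_nat.
Qed.

Lemma invS_le (R : realType) (n m : nat) : (n <= m)%N ->
  m.+1%:R^-1 <= n.+1%:R^-1 :> R.
Proof. by move=> nm; rewrite lef_pV2 ?posrE// ler_nat. Qed.

Lemma cvg_of_sqr_le (R : realType) (a : nat -> R) (b C : R) : 0 <= C ->
  (forall n, (a n - b) ^+ 2 <= C * n.+1%:R^-1) -> a @ \oo --> b.
Proof.
move=> C0 ab; apply/cvgrPdist_lt => e e0.
have C1 : 0 < C + 1 by rewrite ltr_wpDl.
have e2 : 0 < e ^+ 2 / (C + 1) by rewrite divr_gt0// exprn_gt0.
have [N NE] := exists_invS_lt e2; exists N => // n /= Nn.
rewrite distrC -ltr_sqr ?nnegrE// ?ltW// real_normK ?num_real//.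
apply: (le_lt_trans (ab n)).
apply: (@le_lt_trans _ _ ((C + 1) * N.+1%:R^-1)).
  by rewrite ler_pM ?invr_ge0 ?invS_le// lerDl.
by rewrite mulrC -ltr_pdivlMr.
Qed.

(** The form in which the estimate of [near_representation_close] is used, with
  error [n.+1%:R^-1] at rank [n].  Completeness is a hypothesis because the
  lemma serves both for quaternionic Hilbert spaces and for real numbers. *)
Lemma cvg_of_dist (R : realType) (V : pseudoMetricNormedZmodType R)
    (x : nat -> V) :
  (forall F : set_system V, ProperFilter F -> cauchy F -> cvg F) ->
  (forall n m, (n <= m)%N -> `|x n - x m| ^+ 2 <= 4 * n.+1%:R^-1) ->
  cvgn x.
Proof.
move=> complete xc; apply: complete; apply/cauchy_exP => e e0.
have e2 : 0 < e ^+ 2 / 4 by rewrite divr_gt0// exprn_gt0.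
have [N NE] := exists_invS_lt e2.
exists (x N); exists N => // m /= Nm.
rewrite -ball_normE /= -ltr_sqr ?nnegrE// ?ltW//.
by apply: (le_lt_trans (xc _ _ Nm)); rewrite mulrC -ltr_pdivlMr.
Qed.

(** * The real inner product and the adjoint *)

Section RealInnerProduct.
Variables (R : realType) (H : qHilbertType R).
Implicit Types (x y z : H) (p q : quat R).

Definition rdot x y : R := qre (qdot x y).

Lemma rdotC x y : rdot x y = rdot y x.
Proof. by rewrite /rdot qdotC. Qed.

Lemma rdotDr x y z : rdot x (y + z) = rdot x y + rdot x z.
Proof. by rewrite /rdot qdotDr. Qed.

Lemma rdotZr x y t : rdot x (rscale y (real_quat t)) = rdot x y * t.
Proof. rewrite /rdot qdotZr /= !mulr0; lra. Qed.

Lemma sqr_norm_rdot x : `|x| ^+ 2 = rdot x x.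
Proof. exact: sqr_qnorm. Qed.

Lemma rdot_ge0 x : 0 <= rdot x x.
Proof. by rewrite -sqr_norm_rdot sqr_ge0. Qed.

Lemma rdot_Cauchy_Schwarz x y : rdot x y ^+ 2 <= `|x| ^+ 2 * `|y| ^+ 2.
Proof.
rewrite !sqr_norm_rdot.
exact: (form_Cauchy_Schwarz rdotC rdotDr rdotZr rdot_ge0).
Qed.

Lemma rdot0r x : rdot x 0 = 0.
Proof. by apply: (@addrI _ (rdot x 0)); rewrite -rdotDr !addr0. Qed.

Lemma rdotNr x y : rdot x (- y) = - rdot x y.
Proof. by apply: (@addrI _ (rdot x y)); rewrite -rdotDr !subrr rdot0r. Qed.

Lemma rdotBr x y z : rdot x (y - z) = rdot x y - rdot x z.
Proof. by rewrite rdotDr rdotNr. Qed.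

Lemma rdotBl x y z : rdot (x - y) z = rdot x z - rdot y z.
Proof. by rewrite rdotC rdotBr !(rdotC z). Qed.

Lemma rdot_sumr x (T : Type) (s : seq T) (F : T -> H) :
  rdot x (\sum_(i <- s) F i) = \sum_(i <- s) rdot x (F i).
Proof. exact: (big_morph _ (rdotDr x) (rdot0r x)). Qed.

Lemma qdotBr x y z : qdot x (y - z) = qdot x y - qdot x z.
Proof. by apply/eqP; rewrite eq_sym subr_eq -qdotDr subrK. Qed.

Lemma rdot_inj x y : (forall z, rdot x z = rdot y z) -> x = y.
Proof.
move=> xy; apply/eqP; rewrite -subr_eq0 -normr_eq0 -sqrf_eq0 sqr_norm_rdot.
by rewrite rdotBl xy subrr.
Qed.

(** The imaginary parts are recovered by replacing [y] with [rscale y q] for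
  [q = i, j, k]. *)
Lemma qdot_rdotP (H' : qHilbertType R) (x : H) (x' : H') (g : H -> H') :
  (forall y q, g (rscale y q) = rscale (g y) q) ->
  (forall y, rdot x y = qre (qdot x' (g y))) ->
  forall y, qdot x y = qdot x' (g y).
Proof.
move=> gZ xg y; set p := qdot x y; set p' := qdot x' (g y).
have e q : qre (p * q) = qre (p' * q).
  by rewrite -!qdotZr -gZ; exact: xg.
move: p p' e => [a b c d] [a' b' c' d'] e.
by congr Quat; [have := e 1|have := e (Quat 0 1 0 0)|
  have := e (Quat 0 0 1 0)|have := e (Quat 0 0 0 1)]; rewrite /= ; lra.
Qed.

Lemma cvg_rdot (T : Type) (F : set_system T) {FF : Filter F} (f : T -> H) x y :
  f @ F --> x -> (fun t => rdot (f t) y) @ F --> rdot x y.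
Proof.
move=> fx; apply/cvgrPdist_lt => e e0.
have y1 : 0 < `|y| + 1 by rewrite ltr_wpDl.
have e1 : 0 < e / (`|y| + 1) by rewrite divr_gt0.
move/cvgrPdist_lt/(_ _ e1) : fx; apply: filterS => t xt.
rewrite -rdotBl; apply: (@le_lt_trans _ _ (`|x - f t| * `|y|)).
  rewrite -ler_sqr ?nnegrE ?mulr_ge0// real_normK ?num_real// exprMn.
  exact: rdot_Cauchy_Schwarz.
apply: (@le_lt_trans _ _ (`|x - f t| * (`|y| + 1))).
  by rewrite ler_wpM2l// lerDl.
by rewrite -ltr_pdivlMr.
Qed.

End RealInnerProduct.

Section Adjoint.
Variables (R : realType) (H : qHilbertType R).

(** Near-representatives with errors [1 / (n + 1)] form a Cauchy sequence, whose
  limit represents [f]. *)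
Lemma Riesz_rdot (f : H -> R) (C : R) :
  (forall x y, f (x + y) = f x + f y) ->
  (forall x t, f (rscale x (real_quat t)) = f x * t) ->
  0 <= C -> (forall x, f x ^+ 2 <= C * `|x| ^+ 2) ->
  exists l, forall x, rdot l x = f x.
Proof.
move=> fD fZ C0 fC.
have fC' x : f x ^+ 2 <= C * rdot x x by rewrite -sqr_norm_rdot.
have nearB n : exists x, forall y, (rdot x y - f y) ^+ 2 <= n.+1%:R^-1 * rdot y y.
  apply: (near_representation (@rdotC R H) (@rdotDr R H) (@rdotZr R H)
    (@rdot_ge0 R H) fD fZ C0 fC'); by rewrite invr_gt0.
have [x xP] := choice nearB.
have xc n m : (n <= m)%N -> `|x n - x m| ^+ 2 <= 4 * n.+1%:R^-1.
  move=> nm; rewrite sqr_norm_rdot.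
  apply: (near_representation_close (@rdotC R H) (@rdotDr R H) (@rdot_ge0 R H) _ (xP n)).
    by rewrite invr_ge0.
  move=> y; apply: (le_trans (xP m y)).
  by rewrite ler_wpM2r ?rdot_ge0 ?invS_le.
have /cvg_ex[/= l xl] := cvg_of_dist (@qcauchy_cvg R H) xc.
exists l => y.
apply: (cvg_unique _ (cvg_rdot (y := y) xl)) => //.
by apply: (cvg_of_sqr_le (rdot_ge0 y)) => n; rewrite mulrC; exact: xP.
Qed.

(** The choice in the definition of [adjoint] never falls back on its default
  value. *)
Lemma adjointP (L : bounded_op H) (u v : H) :
  qdot (adjoint L u) v = qdot u (L v).
Proof.
rewrite /adjoint; case: xgetP => [w _ /(_ v)//|/(_ _)].
have [M LM] := bop_bounded L.
have [||||l lP] := @Riesz_rdot (fun w => rdot u (L w)) (`|u| ^+ 2 * M ^+ 2).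
- by move=> x y; rewrite bopD rdotDr.
- by move=> x t; rewrite bopZ rdotZr.
- by rewrite mulr_ge0// sqr_ge0.
- move=> x; apply: (le_trans (rdot_Cauchy_Schwarz _ _)).
  rewrite -[leRHS]mulrA ler_wpM2l ?sqr_ge0// -exprMn.
  by rewrite ler_sqr ?nnegrE//; apply: (le_trans _ (LM x)).
move=> /(_ l) []; apply: qdot_rdotP lP => y q; exact: bopZ.
Qed.

End Adjoint.

(** * Quaternions as a Euclidean space *)

Section Quaternion.
Variable R : realType.
Implicit Types p q : quat R.

(** The Euclidean inner product of [R^4], see [pdotE]. *)
Definition pdot p q : R := qre (conjq p * q).

Lemma pdotE p q :
  pdot p q = qre p * qre q + qim p * qim q + qjm p * qjm q + qkm p * qkm q.
Proof. by rewrite /pdot /=; ring. Qed.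

Lemma pdotC p q : pdot p q = pdot q p.
Proof. by rewrite !pdotE; ring. Qed.

Lemma sqr_normq p :
  `|p| ^+ 2 = qre p ^+ 2 + qim p ^+ 2 + qjm p ^+ 2 + qkm p ^+ 2.
Proof. by rewrite sqr_sqrtr// !addr_ge0 ?sqr_ge0. Qed.

Lemma sqr_normq_pdot p : `|p| ^+ 2 = pdot p p.
Proof. by rewrite sqr_normq pdotE !expr2. Qed.

Lemma pdot_le p q (c : R) : 0 < c ->
  pdot p q *+ 2 <= c * `|p| ^+ 2 + c^-1 * `|q| ^+ 2.
Proof.
move=> c0; rewrite -(ler_pM2l c0) [leRHS]mulrDr mulVKf ?gt_eqF//.
rewrite pdotE !sqr_normq.
case: p q => [a b d e] [a' b' d' e'] /=.
have := sqr_ge0 (c * a - a'); have := sqr_ge0 (c * b - b').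
have := sqr_ge0 (c * d - d'); have := sqr_ge0 (c * e - e').
lra.
Qed.

Lemma sqr_normqB_le p q : `|p| ^+ 2 <= 2 * `|q| ^+ 2 + 2 * `|q - p| ^+ 2.
Proof.
rewrite !sqr_normq; case: p q => [a b d e] [a' b' d' e'] /=.
have := sqr_ge0 (a' *+ 2 - a); have := sqr_ge0 (b' *+ 2 - b).
have := sqr_ge0 (d' *+ 2 - d); have := sqr_ge0 (e' *+ 2 - e).
lra.
Qed.

(** The limit is described through the distances to all [p'], since [quat R]
  carries a norm but no topology; it is taken coordinate by coordinate. *)
Lemma cvg_quat (p : nat -> quat R) :
  (forall n m, (n <= m)%N -> `|p n - p m| ^+ 2 <= 4 * n.+1%:R^-1) ->
  exists q, forall p', (fun m => `|p' - p m| ^+ 2) @ \oo --> `|p' - q| ^+ 2.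
Proof.
move=> pc.
have cR (g : quat R -> R) : (forall q q', (g q - g q') ^+ 2 <= `|q - q'| ^+ 2) ->
    cvgn (fun n => g (p n)).
  move=> gle; apply: cvg_of_dist => [F FF Fc|n m nm]; first exact: cauchy_cvg.
  by rewrite real_normK ?num_real// (le_trans (gle _ _))// pc.
have [/cvg_ex[a /= pa] /cvg_ex[b /= pb] /cvg_ex[c /= pc'] /cvg_ex[d /= pd]] :
  [/\ cvgn (fun n => qre (p n)), cvgn (fun n => qim (p n)),
      cvgn (fun n => qjm (p n)) & cvgn (fun n => qkm (p n))].
  by split; apply: cR => q q'; rewrite sqr_normq /=;
    have := sqr_ge0 (qre q - qre q'); have := sqr_ge0 (qim q - qim q');
    have := sqr_ge0 (qjm q - qjm q'); have := sqr_ge0 (qkm q - qkm q'); lra.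
exists (Quat a b c d) => p'; rewrite sqr_normq /=.
under eq_fun do rewrite sqr_normq.
do 3 ?apply: cvgD; rewrite ?expr2; apply: cvgM; apply: cvgB => //; exact: cvg_cst.
Qed.

End Quaternion.

(** * Square-summable families *)

Local Notation totally := summability.totally.
#[local] Existing Instance summability.totally_filter.

Lemma cvg_sum_seq (R : realType) (T J : Type) (F : set_system T) {FF : Filter F}
    (s : seq J) (f : J -> T -> R) (l : J -> R) :
  (forall j, f j @ F --> l j) ->
  (fun t => \sum_(j <- s) f j t) @ F --> \sum_(j <- s) l j.
Proof.
move=> fl; elim: s => [|j s IH].
  by rewrite big_nil; under eq_fun do rewrite big_nil; exact: cvg_cst.
by rewrite big_cons; under eq_fun do rewrite big_cons; exact: cvgD.
Qed.

Section SquareSummable.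
Variables (R : realType) (I : countType).
Implicit Types (p q : I -> quat R) (F G : {fset I}) (c : R).

(** Bounds on finite partial sums keep the whole argument in [R]; [sqsum_esum]
  relates them to extended real sums. *)
Definition sqsum_le p c := forall F, \sum_(i <- F) `|p i| ^+ 2 <= c.

Lemma sqsum_leB p q b c : sqsum_le p b -> sqsum_le q c ->
  sqsum_le (fun i => p i - q i) (2 * b + 2 * c).
Proof.
move=> pb qc F; apply: (@le_trans _ _
  (\sum_(i <- F) (2 * `|p i| ^+ 2 + 2 * `|q i| ^+ 2))); last first.
  by rewrite big_split -!mulr_sumr; apply: lerD; rewrite ler_pM2l.
apply: ler_sum => i _; have := sqr_normqB_le (p i - q i) (p i).
by rewrite subKr.
Qed.

Lemma big_fset_subsetD (V : zmodType) F G (f : I -> V) : (G `<=` F)%fset ->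
  \sum_(i <- F) f i = \sum_(i <- G) f i + \sum_(i <- (F `\` G)%fset) f i.
Proof.
move=> GF; rewrite (big_fsetID _ (mem G)); congr (_ + _); apply: eq_fbigl => i.
  rewrite !inE /=; case: (boolP (i \in G)) => iG; rewrite ?andbF// andbT.
  exact: (fsubsetP GF).
by rewrite !inE /= andbC.
Qed.

Lemma near_totally F : \forall G \near totally, (F `<=` G)%fset.
Proof. by exists F. Qed.

Lemma sqsum_esum p c :
  (\esum_(i in [set: I]) (`|p i| ^+ 2)%:E <= c%:E)%E <-> sqsum_le p c.
Proof.
split=> [h F|h].
  rewrite -lee_fin (le_trans _ h)// -sumEFin.
  apply: ereal_sup_ubound; exists [set` F] => //=.
  by rewrite fsbig_finite//= set_fsetK.
apply: ub_ereal_sup => _ /= [A [Af _] <-].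
by rewrite fsbig_finite//= sumEFin lee_fin.
Qed.

End SquareSummable.

(** * The synthesis operator *)

Section Synthesis.
Variables (R : realType) (I : countType) (H : qHilbertType R).
Variables (w : I -> H) (B : R).
Hypothesis B_gt0 : 0 < B.
Hypothesis bessel : forall z, sqsum_le (fun i => qdot (w i) z) (B * `|z| ^+ 2).
Implicit Types (p q : I -> quat R) (F G : {fset I}) (c : R) (x z : H).

(** Unlike [synthesis], [fsynth] and [synth] apply to all families, so that
  differences and limits of coefficients need no membership proofs. *)
Definition fsynth p : {fset I} -> H :=
  summability.partial_sum (fun i => rscale (w i) (p i)).

Lemma fsynthE p F : fsynth p F = \sum_(i <- F) rscale (w i) (p i).
Proof. by rewrite big_seq_fsetE. Qed.

Lemma rdot_fsynth p F z :
  rdot (fsynth p F) z = \sum_(i <- F) pdot (p i) (qdot (w i) z).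
Proof.
rewrite fsynthE rdotC rdot_sumr; apply: eq_bigr => i _.
by rewrite /rdot qdotZr qdotC pdotE /=; ring.
Qed.

(** Bessel's inequality dualized: [|T| = |T^*|].  With [s] the finite sum,
  [2 |s|^2 = 2 Re <s, s>] is at most [B sum |p_i|^2 + B^-1 sum |<w_i, s>|^2], and
  the second term is at most [|s|^2]. *)
Lemma sqr_sum_le p F :
  `|\sum_(i <- F) rscale (w i) (p i)| ^+ 2 <= B * \sum_(i <- F) `|p i| ^+ 2.
Proof.
rewrite -fsynthE; set s := fsynth p F.
have := bessel s F; set b := \sum_(i <- F) _ => bB.
set c := \sum_(i <- F) _.
suff : `|s| ^+ 2 *+ 2 <= B * c + B^-1 * b.
  have : B^-1 * b <= `|s| ^+ 2 by rewrite ler_pdivrMl.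
  lra.
rewrite [in leLHS]sqr_norm_rdot rdot_fsynth -sumrMnl !mulr_sumr -big_split.
by apply: ler_sum => i _; exact: pdot_le.
Qed.

(** The finite partial sums are Cauchy: once [G] exhausts the sum of squares up to
  [e^2 / B], adding indices to [G] moves the vector by less than [e]. *)
Lemma cvg_fsynth p c : sqsum_le p c -> cvg (fsynth p @ totally).
Proof.
move=> pc; apply: qcauchy_cvg; apply/cauchy_exP => e e0.
pose S := range (fun F => \sum_(i <- F) `|p i| ^+ 2).
have hS : has_sup S.
  split; first by exists (\sum_(i <- fset0 : {fset I}) `|p i| ^+ 2), fset0.
  by exists c => _ [F _ <-]; exact: pc.
have e2 : 0 < e ^+ 2 / B by rewrite divr_gt0// exprn_gt0.
have [_ [G _ <-] GS] := sup_adherent e2 hS.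
exists (fsynth p G); exists G => // F /= GF.
rewrite -ball_normE /= distrC -ltr_sqr ?nnegrE// ?ltW//.
rewrite !fsynthE (big_fset_subsetD _ GF) addrAC subrr add0r.
apply: (le_lt_trans (sqr_sum_le _ _)); rewrite mulrC -ltr_pdivlMr//.
have : \sum_(i <- F) `|p i| ^+ 2 <= sup S by apply: ub_le_sup; [exact: hS.2|exists F].
rewrite (big_fset_subsetD _ GF); lra.
Qed.

Definition synth p : H := lim (fsynth p @ totally).

Lemma synthP p c : sqsum_le p c -> fsynth p @ totally --> synth p.
Proof. exact: cvg_fsynth. Qed.

Lemma synth_le p c : sqsum_le p c -> `|synth p| ^+ 2 <= B * c.
Proof.
move=> pc; have /cvg_norm pn := synthP pc.
have pn2 : (fun F => `|fsynth p F| ^+ 2) @ totally --> `|synth p| ^+ 2.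
  by under eq_fun do rewrite expr2; rewrite expr2; exact: cvgM.
apply: (cvgr_to_le pn2); apply: nearW => F; rewrite fsynthE.
by apply: (le_trans (sqr_sum_le _ _)); rewrite ler_pM2l.
Qed.

Lemma synthB p q b c : sqsum_le p b -> sqsum_le q c ->
  synth (fun i => p i - q i) = synth p - synth q.
Proof.
move=> pb qc; apply/(@cvg_lim H); first exact: norm_hausdorff.
suff -> : fsynth (fun i => p i - q i) = (fun F => fsynth p F - fsynth q F).
  by apply: cvgB; [exact: synthP pb|exact: synthP qc].
apply/funext => F; apply: rdot_inj => z.
rewrite rdotBl !rdot_fsynth -sumrB; apply: eq_bigr => i _.
by rewrite !pdotE /=; ring.
Qed.

Lemma cvg_rdot_synth p c z : sqsum_le p c ->
  (fun F => \sum_(i <- F) pdot (p i) (qdot (w i) z)) @ totally --> rdot (synth p) z.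
Proof.
by move=> /synthP pc; under eq_fun do rewrite -rdot_fsynth; exact: cvg_rdot.
Qed.

(** [Re <T T^* x, z> = Re <T^* x, T^* z>].  Written through [T T^*], it is linear
  in [z] for free. *)
Definition frame_form x z : R := rdot (synth (fun i => qdot (w i) x)) z.

Lemma frame_formC x z : frame_form x z = frame_form z x.
Proof.
apply: (cvg_unique _ (cvg_rdot_synth (z := z) (bessel x))) => //.
apply: cvg_trans (cvg_rdot_synth (z := x) (bessel z)).
by apply: near_eq_cvg; apply: nearW => F; apply: eq_bigr => i _; exact: pdotC.
Qed.

Lemma frame_form_ge x : sqsum_le (fun i => qdot (w i) x) (frame_form x x).
Proof.
move=> G; apply: (cvgr_to_ge (cvg_rdot_synth (z := x) (bessel x))).
apply: filterS (near_totally G) => F GF.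
rewrite (eq_bigr (fun i => pdot (qdot (w i) x) (qdot (w i) x))); last first.
  by move=> i _; exact: sqr_normq_pdot.
rewrite (big_fset_subsetD _ GF) lerDl sumr_ge0// => i _.
by rewrite -sqr_normq_pdot sqr_ge0.
Qed.

Lemma frame_form_ge0 x : 0 <= frame_form x x.
Proof. by apply: le_trans (frame_form_ge x fset0); rewrite big_seq_fset0. Qed.

(** If [z |-> Re <y, z>] is bounded by [|T^* z|] then [y] is in the range of [T].
  Near-representatives [x_n] of this functional for [frame_form] give sequences
  [T^* x_n] that are Cauchy in square sum; their limit [q] satisfies
  [Re <T q, z> = lim Re <T T^* x_n, z> = Re <y, z>]. *)
Lemma synth_of_bounded_functional y C : 0 <= C ->
  (forall z, rdot y z ^+ 2 <= C * frame_form z z) ->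
  exists q c, sqsum_le q c /\ fsynth q @ totally --> y.
Proof.
move=> C0 yC; pose r x i := qdot (w i) x.
have fDr x z z' : frame_form x (z + z') = frame_form x z + frame_form x z'.
  exact: rdotDr.
have fZr x z t : frame_form x (rscale z (real_quat t)) = frame_form x z * t.
  exact: rdotZr.
have nearB n : exists x, forall z,
    (frame_form x z - rdot y z) ^+ 2 <= n.+1%:R^-1 * frame_form z z.
  apply: (near_representation frame_formC fDr fZr frame_form_ge0 _ _ C0 yC).
  - exact: rdotDr.
  - exact: rdotZr.
  - by rewrite invr_gt0.
have [x xP] := choice nearB.
have xc n m : (n <= m)%N -> sqsum_le (fun i => r (x n) i - r (x m) i) (4 * n.+1%:R^-1).
  move=> nm F.
  apply: (@le_trans _ _ (frame_form (x n - x m) (x n - x m))).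
    apply: le_trans (frame_form_ge _ F); apply: ler_sum => i _.
    by rewrite /r -qdotBr.
  apply: (near_representation_close frame_formC fDr frame_form_ge0 _ (xP n)).
    by rewrite invr_ge0.
  move=> z; apply: (le_trans (xP m z)).
  by rewrite ler_wpM2r ?frame_form_ge0 ?invS_le.
have ex_q i : exists a : quat R, forall p' : quat R,
    (fun m => `|p' - r (x m) i| ^+ 2) @ \oo --> `|p' - a| ^+ 2.
  apply: cvg_quat => n m nm.
  by have := xc _ _ nm [fset i]%fset; rewrite big_seq_fset1.
have [q qP] := choice ex_q.
have xq n : sqsum_le (fun i => r (x n) i - q i) (4 * n.+1%:R^-1).
  move=> F; apply: (cvgr_to_le (cvg_sum_seq (fun i => qP i (r (x n) i)))).
  by exists n => // m /= nm; exact: xc.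
(* q is the difference of the square-summable r (x 0) and r (x 0) - q *)
have [c qc] : exists c, sqsum_le q c.
  have := sqsum_leB (frame_form_ge (x 0)) (xq 0).
  under eq_fun do rewrite subKr.
  by eexists; eassumption.
exists q, c; split => //.
suff -> : y = synth q by exact: synthP qc.
apply: rdot_inj => z.
have l1 : (fun n => frame_form (x n) z) @ \oo --> rdot y z.
  apply: (cvg_of_sqr_le (frame_form_ge0 z)) => n.
  by rewrite mulrC; exact: xP.
apply: (cvg_unique _ l1) => //.
apply: (@cvg_of_sqr_le _ _ _ (B * 4 * `|z| ^+ 2)) => [|n].
  by rewrite !mulr_ge0// ltW.
rewrite -rdotBl -(synthB (frame_form_ge (x n)) qc).
apply: (le_trans (rdot_Cauchy_Schwarz _ _)).
rewrite [leRHS]mulrAC ler_wpM2r ?sqr_ge0// -mulrA.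
exact: synth_le (xq n).
Qed.

End Synthesis.

(** * Ranges of K-frames and direct sums *)

Section Kframe.
Variables (R : realType) (I : countType) (H : qHilbertType R).

(** Douglas's lemma for a frame: the lower bound gives
  [(Re <K x, z>)^2 <= |x|^2 |K^* z|^2 <= (|x|^2 / A) |T^* z|^2]. *)
Lemma Kframe_range (K : bounded_op H) (w : I -> H) : is_Kframe K w ->
  forall x, exists q : l2 R I, fsynth w (sval q) @ totally --> K x.
Proof.
move=> [A [B [A0 AB wAB]]] x.
have B0 : 0 < B := lt_le_trans A0 AB.
have bessel z : sqsum_le (fun i => qdot (w i) z) (B * `|z| ^+ 2).
  by apply/sqsum_esum; have /andP[] := wAB z.
have lower z : A * `|adjoint K z| ^+ 2 <= frame_form w z z.
  rewrite -lee_fin; have /andP[h _] := wAB z; apply: (le_trans h).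
  by apply/sqsum_esum; exact: (frame_form_ge B0 bessel z).
have [||q [c [qc qK]]] := synth_of_bounded_functional B0 bessel (y := K x)
    (C := `|x| ^+ 2 / A).
- by rewrite divr_ge0 ?sqr_ge0// ltW.
- move=> z; have -> : rdot (K x) z = rdot (adjoint K z) x.
    by rewrite rdotC /rdot adjointP.
  apply: (le_trans (rdot_Cauchy_Schwarz _ _)).
  by rewrite mulrC -[leRHS]mulrA ler_wpM2l ?sqr_ge0// ler_pdivlMl.
suff q2 : (\esum_(i in [set: I]) (`|q i| ^+ 2)%:E < +oo)%E by exists (exist _ q q2).
by apply: (@le_lt_trans _ _ c%:E); [exact/sqsum_esum|exact: ltry].
Qed.

Lemma synthesis_lim (w : I -> H) (q : l2 R I) (y : H) :
  fsynth w (sval q) @ totally --> y -> synthesis w q = y.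
Proof. by move=> wy; apply/(@cvg_lim H) => //; exact: norm_hausdorff. Qed.

End Kframe.

Section DirectSum.
Variables (R : realType) (I : countType) (H1 H2 : qHilbertType R).

Lemma fsynth_dsum (u : I -> H1) (v : I -> H2) (q : I -> quat R) F :
  fsynth (fun i => dsum_pair (u i) (v i)) q F = dsum_pair (fsynth u q F) (fsynth v q F).
Proof.
by rewrite !fsynthE; elim/big_rec3: _ => // i a b c _ ->.
Qed.

(** The components of a convergent series converge, because the projections of
  the direct sum are contractions. *)
Lemma synthesis_dsum (u : I -> H1) (v : I -> H2) (q : l2 R I) (y : dsum H1 H2) :
  fsynth (fun i => dsum_pair (u i) (v i)) (sval q) @ totally --> y ->
  synthesis u q = y.1 /\ synthesis v q = y.2.
Proof.
move=> /cvgrPdist_lt qy.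
split; apply: synthesis_lim; apply/cvgrPdist_lt => e e0;
  apply: filterS (qy e e0) => F; rewrite fsynth_dsum; apply: le_lt_trans.
- exact: (norm1_le_dsum (y - dsum_pair _ _)).
- exact: (norm2_le_dsum (y - dsum_pair _ _)).
Qed.

End DirectSum.

Lemma bop0 (R : realType) (H : qHilbertType R) (K : bounded_op H) : K 0 = 0.
Proof. by apply: (@addrI _ (K 0)); rewrite -bopD !addr0. Qed.

Theorem theorem13 (R : realType) (I : countType) (H1 H2 : qHilbertType R)
    (K1 : bounded_op H1) (K2 : bounded_op H2) (u : I -> H1) (v : I -> H2) :
  is_Kframe K1 u -> is_Kframe K2 v ->
  is_Kframe (dsum_op K1 K2) (fun i => dsum_pair (u i) (v i)) ->
  range K1 `<=` synthesis u @` ker (synthesis v) /\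
  range K2 `<=` synthesis v @` ker (synthesis u).
Proof.
move=> _ _ uv; split=> _ [x _ <-].
- have [q /synthesis_dsum[/= uq vq]] := Kframe_range uv (dsum_pair x 0).
  by exists q => //; rewrite /ker /= vq bop0.
- have [q /synthesis_dsum[/= uq vq]] := Kframe_range uv (dsum_pair 0 x).
  by exists q => //; rewrite /ker /= uq bop0.
Qed.
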